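(* Let $G$ be a unicyclic graph with $n \ge 4$ vertices and maximum degree $\Delta\ge 3$, and let $q=\lfloor \frac{n}{\Delta-1}\rfloor$. If $q=1$ or $n=2\Delta-2$, then $$ NK^*(G) \le 4\,\Delta^\Delta (n-\Delta+1)^{n-\Delta+1}. $$ If $q>1$ and $n\ne 2\Delta-2$, then $$ NK^*(G) \le \Delta^{q\Delta} \big(n-q(\Delta-1)+1\big)^{n-q(\Delta-1)+1}. $$ Moreover, in each case the upper bound is attained if and only if $G\in\mathcal{K}_n^\Delta$.
   Context: All graphs are finite, connected, simple (no loops, no multiple edges) and have at least one edge. A unicyclic graph is a graph containing exactly one cycle. For a vertex $u$ of $G$, $d_u$ denotes its degree. The multiplicative second Zagreb index (modified Narumi-Katayama index) is $NK^*(G)=\prod_{uv\in E(G)} d_u d_v=\prod_{u\in V(G)} d_u^{d_u}$. For $n\ge 4$, $3\le\Delta\le n-1$ and $q=\lfloor \frac{n}{\Delta-1}\rfloor$, define the $n$-tuple $\mathbf{z}$ as follows. If $q=1$ or $n=2\Delta-2$, then $\mathbf{z}=(\Delta,\,n-\Delta+1,\,2,\,1,\dots,1)$ with $n-3$ entries equal to $1$ at the end. If $q\ge 2$ and $n\ne 2\Delta-2$, then $\mathbf{z}=(z_1,\dots,z_n)$ with $z_j=\Delta$ for $1\le j\le q$, $z_{q+1}=n-q(\Delta-1)+1$, and $z_j=1$ for $q+1<j\le n$. $\mathcal{K}_n^\Delta$ is the set of unicyclic graphs with $n$ vertices whose degree sequence (in non-increasing order) is $\mathbf{z}$. *)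

(* Defs.v *)
From mathcomp Require Import all_boot.
Set Implicit Arguments.
Unset Strict Implicit.
Unset Printing Implicit Defensive.

Record sgraph := SGraph {
  vertex :> finType;
  adj : rel vertex;
  adj_sym : symmetric adj;
  adj_irr : irreflexive adj }.

Definition edges (G : sgraph) : {set {set G}} :=
  [set [set x; y] | x in G, y in G & adj x y].

Definition deg (G : sgraph) (x : G) : nat := #|[set y | adj x y]|.

Definition max_degree (G : sgraph) : nat := \max_(x : G) deg x.

Definition degree_sequence (G : sgraph) : seq nat :=
  sort geq [seq deg x | x : G].

Definition connected (G : sgraph) : Prop :=
  forall x y : G, connect (@adj G) x y.

(* A cycle is a subgraph, represented by its edge set: the closed vertex
   sequences that differ only by rotation or reversal are the same cycle. *)
Definition cycle_edges (G : sgraph) (c : seq G) : {set {set G}} :=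
  [set [set x; next c x] | x in c].

(* [ucycle] alone would also accept [:: x; y] for an edge xy. *)
Definition is_cycle (G : sgraph) (C : {set {set G}}) : Prop :=
  exists c : seq G, [/\ 2 < size c, ucycle (@adj G) c & C = cycle_edges c].

Definition unicyclic (G : sgraph) : Prop :=
  connected G /\ exists! C : {set {set G}}, is_cycle C.

Definition NKstar (G : sgraph) : nat :=
  \prod_(uv in edges G) \prod_(u in uv) deg u.

(* For 3 <= Delta <= n - 1 none of the subtractions below truncates. *)
Definition ztuple (n Delta : nat) : seq nat :=
  let q := n %/ (Delta - 1) in
  if (q == 1) || (n == 2 * Delta - 2)
  then [:: Delta; n - Delta + 1; 2] ++ nseq (n - 3) 1
  else nseq q Delta ++ (n - q * (Delta - 1) + 1) :: nseq (n - q - 1) 1.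

Definition K_class (n Delta : nat) (G : sgraph) : Prop :=
  [/\ unicyclic G, #|G| = n & degree_sequence G = ztuple n Delta].

(* Main.v *)
Require Import Defs.
From mathcomp Require Import all_boot zify.
Set Implicit Arguments.
Unset Strict Implicit.
Unset Printing Implicit Defensive.

(* Grouping the edge factors by endpoints, NK*(G) is the product of d^d over
   the degrees d. A connected graph with a single cycle has as many edges as
   vertices, so the excesses d - 1 are integers between 0 and Delta - 1 with
   sum n, and at least three of them (on the cycle) are positive. As k^k is
   strictly log-convex, moving units from smaller to larger excesses increases
   the product. It is thus largest exactly when the excesses are packed into as
   many entries Delta - 1 as possible plus one remainder, except that for
   n <= 2 Delta - 2 this leaves at most two positive entries, and one unit must
   be kept for a third vertex. *)

(** * Strict log-convexity of [k ^ k] *)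

Definition selfpow k := k ^ k.

Lemma selfpow_gt0 k : 0 < selfpow k.
Proof. by rewrite /selfpow; case: k => // k; rewrite expn_gt0. Qed.

(** Bernoulli's inequality [(1 - 1/(x+1))^j >= 1 - j/(x+1)], cleared of denominators. *)
Lemma bernoulli_nat x j : j <= x -> x.+1 ^ j * (x.+1 - j) <= x ^ j * x.+1.
Proof.
elim: j => [|j IHj] lejx; first by rewrite subn0.
have {}IHj := IHj (ltnW lejx).
have: x.+1 * (x.+1 - j.+1) <= x * (x.+1 - j).
  have [k ->] : exists k, x = j.+1 + k by exists (x - j.+1); lia.
  have -> : (j.+1 + k).+1 - j.+1 = k.+1 by lia.
  have -> : (j.+1 + k).+1 - j = k.+2 by lia.
  nia.
rewrite -(leq_pmul2l (_ : 0 < x.+1 ^ j)) ?expn_gt0 // => le1.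
rewrite !expnS.
have: x * (x.+1 ^ j * (x.+1 - j)) <= x * (x ^ j * x.+1) by rewrite leq_mul2l IHj orbT.
lia.
Qed.

(** For [k > 0], Bernoulli with [x + 1 = (k+1)^2] and [j = k] bounds [(k(k+2)/(k+1)^2)^k] below by
    [(k^2+k+1)/(k+1)^2]. Then [(k+1)^3 <= (k+2)(k^2+k+1)] gives [le1], and [k+1 < k+2] makes the
    result strict. *)
Lemma selfpow_logconvex k : selfpow k.+1 * selfpow k.+1 < selfpow k.+2 * selfpow k.
Proof.
case: (posnP k) => [-> //|k0].
have := @bernoulli_nat (k * k.+2) k (leq_pmulr k (ltn0Sn k.+1)).
have -> : (k * k.+2).+1 = k.+1 * k.+1 by lia.
have -> : k.+1 * k.+1 - k = k * k + k + 1 by lia.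
rewrite !expnMn /selfpow !expnS.
have : 0 < k ^ k * k.+2 ^ k by rewrite muln_gt0 !expn_gt0 k0.
rewrite (_ : k.+2 * (k.+2 * k.+2 ^ k) * k ^ k = k.+2 * k.+2 * (k ^ k * k.+2 ^ k)); last by lia.
move=> BC0 Bk; rewrite [ltnLHS]mulnACA [ltnLHS]mulnC.
move: (k ^ k * _) BC0 Bk => BC BC0.
move: (k.+1 ^ k * _) => AA Bk.
have le1 : AA * k.+1 <= k.+2 * BC.
  rewrite -(@leq_pmul2r (k.+1 * k.+1)) //.
  have lek : k.+1 * (k.+1 * k.+1) <= k.+2 * (k * k + k + 1) by lia.
  have := leq_mul (leqnn AA) lek; have := leq_mul (leqnn k.+2) Bk; lia.
have := leq_mul (leqnn k.+1) le1.
have : k.+1 * (k.+2 * BC) < k.+2 * k.+2 * BC by rewrite mulnA !ltn_pmul2r.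
lia.
Qed.

Lemma selfpow_ratio_lt b c : b < c ->
  selfpow b.+1 * selfpow c < selfpow c.+1 * selfpow b.
Proof.
elim: c => // c IHc; rewrite ltnS leq_eqVlt => /orP[/eqP-> | /IHc {}IHc].
  exact: selfpow_logconvex.
have := selfpow_logconvex c; have := selfpow_gt0 c; have := selfpow_gt0 c.+1.
have := selfpow_gt0 b; have := selfpow_gt0 b.+1.
move: (selfpow c) (selfpow c.+1) (selfpow c.+2) (selfpow b) (selfpow b.+1) IHc.
move=> C C1 C2 B B1 lt1 B1p Bp C1p Cp lt2.
(* The product of [lt1] and [lt2] is the goal times [C * C1]. *)
rewrite -(@ltn_pmul2r (C * C1)) ?muln_gt0 ?Cp //.
have := ltn_mul lt1 lt2; lia.
Qed.

(** Multiply the ratio inequalities at [b + i] and [c + i] for [i < k]: of two pairs with equal sum,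
    the wider one wins. *)
Lemma selfpow_spread b c k : b < c -> 0 < k ->
  selfpow (b + k) * selfpow c < selfpow b * selfpow (c + k).
Proof.
move=> ltbc; case: k => // k _; elim: k => [|k IHk].
  by rewrite !addn1 [ltnRHS]mulnC; apply: selfpow_ratio_lt.
rewrite (addnS b k.+1) (addnS c k.+1).
have := @selfpow_ratio_lt (b + k.+1) (c + k.+1); rewrite ltn_add2r => /(_ ltbc) lt2.
have Pb := selfpow_gt0 (b + k.+1); have Pc := selfpow_gt0 (c + k.+1).
rewrite -(@ltn_pmul2r (selfpow (b + k.+1) * selfpow (c + k.+1))) ?muln_gt0 ?Pb //.
have := ltn_mul IHk lt2; lia.
Qed.

(** * Maximal weight of lists with given sum and bounded entries *)

(* The entries [a] of the lists below are excesses [deg x - 1]; zero entries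
   contribute the factor [1], so lists are compared up to zeros. *)
Definition weight (s : seq nat) := \prod_(a <- s) selfpow a.+1.

Definition eq_upto0 (s t : seq nat) :=
  perm_eq [seq a <- s | a != 0] [seq a <- t | a != 0].

Lemma eq_upto0_trans : transitive eq_upto0.
Proof. by move=> s t u; apply: perm_trans. Qed.

Lemma perm_eq_upto0 s t : perm_eq s t -> eq_upto0 s t.
Proof. exact: perm_filter. Qed.

Lemma eq_upto0_cons a s t : eq_upto0 s t -> eq_upto0 (a :: s) (a :: t).
Proof. by rewrite /eq_upto0 /=; case: ifP => //; rewrite perm_cons. Qed.

Lemma weight_cons a s : weight (a :: s) = selfpow a.+1 * weight s.
Proof. by rewrite /weight big_cons. Qed.

Lemma weight_gt0 s : 0 < weight s.
Proof. by rewrite /weight prodn_gt0 // => a; apply: selfpow_gt0. Qed.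

Lemma weight_filter s : weight [seq a <- s | a != 0] = weight s.
Proof. by elim: s => //= -[|a] s IHs; rewrite !weight_cons ?mul1n IHs. Qed.

Lemma eq_upto0_weight s t : eq_upto0 s t -> weight s = weight t.
Proof.
by move=> st; rewrite -weight_filter -[RHS]weight_filter; apply: perm_big.
Qed.

(** Equal lengths force equal numbers of zeros. *)
Lemma eq_upto0_perm s t : size s = size t -> eq_upto0 s t -> perm_eq s t.
Proof.
move=> eqsz st.
have zeros u : [seq a <- u | ~~ (a != 0)] = nseq (size u - count (fun a => a != 0) u) 0.
  by elim: u => //= -[|a] u IHu //=; rewrite ?add0n ?subSn ?count_size //= IHu.
rewrite -(perm_filterC (fun a => a != 0) s) /predC zeros.
rewrite perm_sym -(perm_filterC (fun a => a != 0) t) /predC zeros.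
by rewrite eqsz -!size_filter (perm_size st) perm_cat2r perm_sym.
Qed.

Lemma weight_leqif s t : weight s <= weight t ->
  (weight s = weight t -> eq_upto0 s t) -> weight s <= weight t ?= iff eq_upto0 s t.
Proof.
move=> lest eqst; split=> //; apply/eqP/idP => //; exact: eq_upto0_weight.
Qed.

Lemma weight_leqif_congr s s' t t' : eq_upto0 s s' -> eq_upto0 t t' ->
  weight s <= weight t ?= iff eq_upto0 s t ->
  weight s' <= weight t' ?= iff eq_upto0 s' t'.
Proof.
move=> ss' tt'; rewrite (eq_upto0_weight ss') (eq_upto0_weight tt').
by rewrite /eq_upto0 (permPl ss') (permPr tt').
Qed.

(** The maximiser for sum [N] and entries at most [m]; its remainder entry may be zero. *)
Definition packed m N := N %% m :: nseq (N %/ m) m.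

(** With remainder [r], the pair [a, r] becomes [0, r + a] or [m, r + a - m]. Either change spreads
    the pair, strictly unless [a = 0], [r = 0] or [a = m]. *)
Lemma packed_step m N a : 0 < m -> a <= m ->
  weight (a :: packed m N) <= weight (packed m (N + a))
    ?= iff eq_upto0 (a :: packed m N) (packed m (N + a)).
Proof.
move=> m0 leam; rewrite /packed.
have ltrm : N %% m < m by rewrite ltn_mod.
rewrite {3 4 7 8}(divn_eq N m) -addnA modnMDl divnMDl //.
move: (N %% m) (N %/ m) ltrm => r q ltrm.
have [ltm|lem] := ltnP (r + a) m.
  rewrite modn_small // divn_small // addn0.
  case: (posnP a) => [->|a0].
    by rewrite addn0 weight_cons mul1n; apply/leqif_refl/perm_refl.
  case: (posnP r) => [->|r0].
    by rewrite add0n !weight_cons (mul1n (weight _)); apply/leqif_refl/perm_refl.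
  (* The base [1] is the degree of a vertex with excess [0]. *)
  have lt1 := @selfpow_spread 1 a.+1 r a0 r0.
  have lt : weight [:: a, r & nseq q m] < weight (r + a :: nseq q m).
    rewrite !weight_cons mulnA ltn_pmul2r ?weight_gt0 //.
    by move: lt1; rewrite {2}/selfpow mul1n add1n addSn [a + r]addnC [ltnLHS]mulnC.
  by apply: weight_leqif; [apply: ltnW | move=> E; rewrite E ltnn in lt].
have [j Ej] : exists j, r + a = m + j by exists (r + a - m); lia.
have ltjm : j < m by lia.
rewrite Ej modnDl divnDl ?dvdnn // divnn m0 modn_small // divn_small // addn0 addn1.
case: (eqVneq a m) => [Ea|neqam].
  have -> : j = r by lia.
  rewrite Ea; apply: weight_leqif => [|_].
    by rewrite /= !weight_cons mulnCA.
  by apply: perm_eq_upto0; rewrite (perm_catCA [:: m] [:: r]).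
have lt : weight [:: a, r & nseq q m] < weight (j :: nseq q.+1 m).
  rewrite /= !weight_cons !mulnA ltn_pmul2r ?weight_gt0 //.
  have := @selfpow_spread j.+1 a.+1 (m - a).
  have -> : j.+1 + (m - a) = r.+1 by lia.
  have -> : a.+1 + (m - a) = m.+1 by lia.
  by rewrite mulnC; apply; lia.
by apply: weight_leqif; [apply: ltnW | move=> E; rewrite E ltnn in lt].
Qed.

(** Pack the tail by induction, then absorb the head by [packed_step]; overall equality forces
    equality in both steps. *)
Lemma weight_packed m s : 0 < m -> all (leq^~ m) s ->
  weight s <= weight (packed m (sumn s)) ?= iff eq_upto0 s (packed m (sumn s)).
Proof.
move=> m0; elim: s => [_|a s IHs /= /andP[leam /IHs {}IHs]].
  rewrite /packed /= div0n mod0n; apply: weight_leqif => //.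
  by rewrite weight_cons (mul1n (weight _)).
have step := @packed_step m (sumn s) a m0 leam; rewrite addnC in step.
have le1 : weight (a :: s) <= weight (a :: packed m (sumn s)).
  by rewrite !(weight_cons a) leq_mul2l IHs orbT.
apply: weight_leqif; first exact: leq_trans le1 step.
move=> E; have /eqP : weight (a :: s) = weight (a :: packed m (sumn s)).
  by apply/eqP; rewrite eqn_leq le1 E step.
rewrite !(weight_cons a) eqn_pmul2l ?selfpow_gt0 // IHs => /(eq_upto0_cons a) s_pack.
by apply: eq_upto0_trans (s_pack) _; rewrite -step -E (eq_upto0_weight s_pack).
Qed.

(* A smallest positive entry can be decreased in favour of an entry below [m],
   which exists since two entries [m] would exceed the total; this ends with an
   entry [1], and [weight_packed] applies to the other entries. *)
Lemma weight_three m c a b s : 0 < c -> c <= a -> c <= b ->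
  all (leq^~ m) [:: c, a, b & s] ->
  m + 2 <= sumn [:: c, a, b & s] <= 2 * m ->
  let t := [:: m; sumn [:: c, a, b & s] - m.+1; 1] in
  weight [:: c, a, b & s] <= weight t ?= iff eq_upto0 [:: c, a, b & s] t.
Proof.
case: c => // c _; elim: c a b => [|c IHc] a b leca lecb les lesum t.
  have les' : all (leq^~ m) [:: a, b & s] by case/andP: les.
  have m0 : 0 < m by move: lesum => /=; lia.
  have ltm : sumn [:: 1, a, b & s] - m.+1 < m by move: lesum => /=; lia.
  have Es : sumn [:: a, b & s] = m + (sumn [:: 1, a, b & s] - m.+1).
    by move: lesum => /=; lia.
  move: (_ - _) ltm Es @t => k ltkm Es t.
  (* Since [k < m], the entries other than [1] pack into one [m] and the remainder [k]. *)
  have := weight_packed m0 les'; rewrite /packed Es.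
  rewrite modnDl divnDl ?dvdnn // divnn m0 modn_small // divn_small // addn0 => H.
  have tE : eq_upto0 [:: 1; k; m] t.
    by apply: perm_eq_upto0; rewrite -[X in perm_eq X _]/(rev [:: m; k; 1]) perm_rev.
  apply: weight_leqif.
    by rewrite -(eq_upto0_weight tE) !(weight_cons 1) leq_mul2l H orbT.
  rewrite -(eq_upto0_weight tE) !(weight_cons 1) => /eqP.
  rewrite eqn_pmul2l ?selfpow_gt0 // H => /(eq_upto0_cons 1) E.
  exact: eq_upto0_trans E tE.
wlog ltbm : a b leca lecb les lesum @t / b < m.
  move=> wl; have [ltbm|lemb] := ltnP b m; first exact: wl.
  have Cs : perm_eq [:: c.+2, a, b & s] [:: c.+2, b, a & s].
    by rewrite perm_cons (perm_catCA [:: a] [:: b]).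
  have Cz : sumn [:: c.+2, a, b & s] = sumn [:: c.+2, b, a & s] by rewrite /= (addnCA a).
  have := wl b a lecb leca; rewrite -Cz -(perm_all _ Cs).
  move=> /(_ les lesum) H.
  have Cu := perm_eq_upto0 Cs; rewrite /eq_upto0 perm_sym in Cu.
  by apply: weight_leqif_congr Cu (perm_refl _) _; apply: H; move: lesum => /=; lia.
have Ez : sumn [:: c.+1, a, b.+1 & s] = sumn [:: c.+2, a, b & s] by rewrite /=; lia.
(* Moving a unit from [c.+2] to [b] is strict, so equality is excluded when the smallest entry
   exceeds [1]. *)
have lt : weight [:: c.+2, a, b & s] < weight t.
  have := IHc a b.+1; rewrite Ez -/t => H.
  apply: leq_trans (_ : weight [:: c.+1, a, b.+1 & s] <= _).
    rewrite !weight_cons mulnCA [ltnRHS]mulnCA ltn_pmul2l ?selfpow_gt0 //.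
    rewrite !(mulnA (selfpow _) (selfpow _)) ltn_pmul2r ?weight_gt0 //.
    by have := @selfpow_spread c.+2 b.+1 1; rewrite !addn1; apply.
  by apply H => //; [lia|lia|move: les => /=; lia].
by apply: weight_leqif; [apply: ltnW | move=> E; rewrite E ltnn in lt].
Qed.

Lemma three_nonzero s : 2 < count (fun a => a != 0) s ->
  exists c a b r, [/\ perm_eq s [:: c, a, b & r], 0 < c, c <= a & c <= b].
Proof.
rewrite -size_filter -(size_sort leq).
have : all (fun a => a != 0) (sort leq [seq a <- s | a != 0]).
  by rewrite all_sort filter_all.
have := sort_sorted leq_total [seq a <- s | a != 0].
have : perm_eq (sort leq [seq a <- s | a != 0]) [seq a <- s | a != 0].
  by rewrite perm_sort.
case: (sort leq _) => [|c [|a [|b r]]] //= Hp /and3P[leca leab _] /andP[c0 _] _.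
exists c, a, b, (r ++ [seq a <- s | ~~ (a != 0)]).
split; rewrite ?lt0n //; last exact: leq_trans leab.
rewrite -(perm_filterC (fun a => a != 0) s) -!cat_cons perm_cat2r.
by rewrite perm_sym.
Qed.

Lemma eq_upto0_cat_nseq s k : eq_upto0 s (s ++ nseq k 0).
Proof. by rewrite /eq_upto0 filter_cat filter_nseq cats0 perm_refl. Qed.

(** * Incidences, and the number of edges of a unicyclic graph *)

Section Graph.
Variable G : sgraph.
Implicit Types (x y : G) (c : seq G).

Lemma adj_neq x y : adj x y -> x != y.
Proof. by apply: contraTneq => ->; rewrite adj_irr. Qed.

Lemma edgesP e : reflect (exists x y, adj x y /\ e = [set x; y]) (e \in edges G).
Proof.
apply: (iffP imset2P) => [[x y _ Hy ->]|[x [y [xy ->]]]].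
  by exists x, y; split=> //; move: Hy; rewrite !inE.
by exists x y; rewrite ?inE.
Qed.

Lemma card_incident x : #|[set e in edges G | x \in e]| = deg x.
Proof.
rewrite /deg -(@card_in_imset _ _ (fun y => [set x; y])).
  apply: eq_card => e; rewrite inE; apply/andP/imsetP => [[/edgesP[u [v [uv ->]]]]|[y]].
    rewrite !inE => /orP[]/eqP->; first by exists v; rewrite ?inE.
    by exists u; rewrite ?inE 1?adj_sym // setUC.
  rewrite inE => xy ->; split; last by rewrite !inE eqxx.
  by apply/edgesP; exists x, y.
move=> y z; rewrite !inE => xy xz /setP/(_ y); rewrite !inE eqxx orbT.
by rewrite eq_sym (negPf (adj_neq xy)) /= => /esym/eqP.
Qed.

Lemma NKstarE : NKstar G = \prod_(x : G) deg x ^ deg x.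
Proof.
rewrite /NKstar (exchange_big_dep xpredT) //=; apply: eq_bigr => x _.
by rewrite prod_nat_const -card_incident; congr (_ ^ _); apply: eq_card => e; rewrite inE.
Qed.

Lemma handshake : \sum_(x : G) deg x = 2 * #|edges G|.
Proof.
under eq_bigr => x _ do rewrite -card_incident -sum1_card.
have E : \sum_(x : G) \sum_(e in [set e in edges G | x \in e]) 1 =
         \sum_(e in edges G) \sum_(x in e) 1.
  rewrite [RHS](exchange_big_dep xpredT) //=; apply: eq_bigr => x _.
  by apply: eq_bigl => e; rewrite inE.
rewrite E mulnC -sum_nat_const; apply: eq_bigr => e /edgesP[x [y [xy ->]]].
by rewrite sum1_card cards2 (adj_neq xy).
Qed.

(** Length above 2 separates a cycle from an edge walked back and forth. *)
Lemma next_next_neq c x : uniq c -> 2 < size c -> x \in c -> next c (next c x) != x.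
Proof.
move=> Uc + xc; have [i s Es] := rot_to xc.
rewrite -(size_rot i) -!(next_rot i Uc) // Es.
move: Uc; rewrite -(rot_uniq i) Es.
case: s {Es} => [|y [|z s]] //= /and3P[].
rewrite !inE !negb_or => /and3P[xy xz _] /andP[yz _] _ _.
by rewrite eqxx /= [y == x]eq_sym (negPf xy) eqxx eq_sym.
Qed.

(** The predecessor and successor on the cycle are distinct neighbours. *)
Lemma deg_cycle c x : 2 < size c -> ucycle (@adj G) c -> x \in c -> 1 < deg x.
Proof.
move=> szc /andP[Cc Uc] xc.
have N1 := next_cycle Cc xc; have N2 := prev_cycle Cc xc.
have ne : prev c x != next c x.
  apply: contraTneq (next_next_neq Uc szc (_ : prev c x \in c)) => [E|]; last by rewrite mem_prev.
  by rewrite next_prev // -E eqxx.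
rewrite /deg (leq_trans _ (subset_leq_card (_ : [set prev c x; next c x] \subset _))) //.
  by rewrite cards2 ne.
by apply/subsetP => y; rewrite !inE => /orP[]/eqP-> //; rewrite adj_sym.
Qed.

(** Off the cycle, [f x] is the next vertex on a shortest path to [c], and [dist] is the length of
    such a path. *)
Lemma parent_function c : 2 < size c -> ucycle (@adj G) c -> connected G ->
  exists (f : G -> G) (dist : G -> nat),
  [/\ forall x, adj x (f x), {in c, f =1 next c} &
      forall x, x \notin c -> dist (f x) < dist x].
Proof.
move=> szc /andP[Cc Uc] conn.
pose reach x k := [exists p : k.-tuple G, path (@adj G) x p && (last x p \in c)].
have reachP x : exists k, reach x k.
  case: c szc {Cc Uc} @reach => // z c' _ reach.
  have /connectP[p xp Ez] := conn x z.
  exists (size p); apply/existsP; exists (in_tuple p).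
  by rewrite xp -Ez inE eqxx.
pose dist x := ex_minn (reachP x).
have parent x : exists y, [/\ adj x y, x \in c -> y = next c x &
                               x \notin c -> dist y < dist x].
  have [xc|xNc] := boolP (x \in c).
    by exists (next c x); split=> //; apply: next_cycle.
  rewrite /dist; case: ex_minnP => k /existsP[[p /= /eqP szp] /andP[/= xp lst]] _.
  case: p szp xp lst => [|y p] /= szp; first by move=> _; rewrite (negPf xNc).
  case/andP=> xy yp lst; exists y; split=> // _.
  case: ex_minnP => l _ /(_ (size p)); rewrite -szp ltnS; apply.
  by apply/existsP; exists (in_tuple p); rewrite yp lst.
have [f Hf] := fin_all_exists parent.
by exists f, dist; split=> x; case: (Hf x).
Qed.

(* The edges [{x, f x}] of a parent function [f] are [n] distinct ones; any other
   edge [xy] would close a second cycle with the path from [x] to [y] that they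
   provide. *)
Lemma card_edges_unicyclic : unicyclic G -> #|edges G| = #|G|.
Proof.
case=> conn [C [[c [szc Cc EC]] Cuniq]].
have [f [dist [adjf fc distf]]] := parent_function szc Cc conn.
have /andP[cyc Uc] := Cc.
have fcyc x : x \in c -> f x \in c by move=> xc; rewrite fc // mem_next.
(* If [{x, f x} = {y, f y}] with [x != y], then [f] swaps [x] and [y]; excluding this makes the
   parent edges distinct. *)
have noback x : f (f x) != x.
  have [xc|xNc] := boolP (x \in c).
    by rewrite !fc ?mem_next // next_next_neq.
  have [fxc|fxNc] := boolP (f x \in c).
    by apply: contraNneq xNc => <-; apply: fcyc.
  have := ltn_trans (distf _ fxNc) (distf _ xNc).
  by apply: contraTneq => ->; rewrite ltnn.
pose fe x := [set x; f x].
have fe_inj : injective fe.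
  move=> x y /setP Exy; apply/eqP; apply/negPn/negP => neq.
  have := Exy x; rewrite !inE eqxx (negPf neq) /= => /esym/eqP Ex.
  have := Exy y; rewrite !inE eqxx eq_sym (negPf neq) /= => /eqP Ey.
  by have := noback x; rewrite -Ey -Ex eqxx.
have feE : [set fe x | x : G] = edges G; last by rewrite -feE card_imset.
apply/eqP; rewrite eqEsubset; apply/andP; split.
  by apply/subsetP => _ /imsetP[x _ ->]; apply/edgesP; exists x, (f x).
apply/subsetP => e eE; apply/negPn/negP => eNf.
have /edgesP[x [y [xy Ee]]] := eE.
pose tree := [rel u v | (f u == v) || (f v == u)].
have tree_sym : symmetric tree by move=> u v; rewrite /= orbC.
have tree_adj : subrel tree (@adj G).
  by move=> u v /orP[]/eqP<- //; rewrite adj_sym.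
have csym := sym_connect_sym tree_sym.
have to_c u : exists2 v, v \in c & connect tree u v.
  have [k] := ubnP (dist u); elim: k u => // k IHk u ltk.
  have [uc|uNc] := boolP (u \in c); first by exists u.
  have [v vc fuv] := IHk (f u) (leq_trans (distf _ uNc) ltk).
  by exists v => //; apply: connect_trans fuv; apply: connect1; rewrite /= eqxx.
have in_c u v : u \in c -> v \in c -> connect tree u v.
  move=> uc vc.
  have Ct : cycle tree c by apply: cycle_from_next => // w wc; rewrite /= fc // eqxx.
  exact: connect_cycle Ct _ _ uc vc.
have /connectP[p0 xp0 Ey0] : connect tree x y.
  have [u uc xu] := to_c x; have [v vc yv] := to_c y.
  apply: connect_trans xu _; apply: connect_trans (in_c _ _ uc vc) _.
  by rewrite csym.
move: Ey0; case/shortenP: xp0 => p xp Up _ Ey.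
(* A shorter path would make [e] a loop or a parent edge. *)
have szp : 1 < size p.
  case: p xp Up Ey => [|z [|? ?]] //= => [_ _ Ey|].
    by rewrite Ey adj_irr in xy.
  rewrite andbT => xz _ Ey; case/negP: eNf; rewrite Ee Ey.
  by case/orP: xz => /eqP<-; last rewrite setUC; apply: imset_f.
have Cp : ucycle (@adj G) (x :: p).
  rewrite /ucycle Up andbT /= rcons_path (sub_path tree_adj xp) -Ey /=.
  by rewrite adj_sym.
(* By uniqueness the closed path has the edges of [c], all of them parent edges, yet it contains
   [e]. *)
have := Cuniq _ (ex_intro _ (x :: p) (And3 (_ : 2 < size (x :: p)) Cp erefl)).
move=> /(_ szp); rewrite EC => Eqc.
have : e \in cycle_edges (x :: p).
  apply/imsetP; exists y; first by rewrite Ey mem_last.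
  rewrite Ee setUC; congr [set _; _].
  case/lastP: p szp {xp Cp Eqc} Up Ey => // p z _ Up; rewrite last_rcons => ->.
  by rewrite -(next_rotr 1 Up) -rcons_cons rotr1_rcons /= eqxx.
rewrite -Eqc => /imsetP[w wc Ew]; case/negP: eNf.
by rewrite Ew -fc //; apply: (imset_f fe).
Qed.
End Graph.

(** * The excess list of a unicyclic graph *)

Section Excess.
Variable G : sgraph.
Hypothesis hG : unicyclic G.

Definition excess := [seq (deg x).-1 | x : G].

Lemma unicyclic_deg_gt0 (x : G) : 0 < deg x.
Proof.
case: hG => conn [C [[c [szc Cc _]] _]].
have [f [dist [adjf _ _]]] := parent_function szc Cc conn.
by rewrite /deg card_gt0; apply/set0Pn; exists (f x); rewrite inE.
Qed.

Lemma succn_excess : map succn excess = [seq deg x | x : G].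
Proof.
by rewrite -map_comp; apply: eq_map => x /=; rewrite prednK ?unicyclic_deg_gt0.
Qed.

Lemma weight_excess : weight excess = NKstar G.
Proof.
rewrite NKstarE /weight big_map big_enum; apply: eq_bigr => x _.
by rewrite prednK ?unicyclic_deg_gt0.
Qed.

(** The degrees sum to twice the number of edges, that is [2n]; subtracting 1 per vertex leaves
    [n]. *)
Lemma sumn_excess : sumn excess = #|G|.
Proof.
have E := handshake G; rewrite card_edges_unicyclic // in E.
have : \sum_(x : G) deg x = \sum_(x : G) (deg x).-1 + \sum_(x : G) 1.
  rewrite -big_split; apply: eq_bigr => x _ /=.
  by rewrite addn1 prednK ?unicyclic_deg_gt0.
rewrite E sum1_card sumnE big_map big_enum /= => E2.
apply/eqP; rewrite -(eqn_add2r #|G|) addnn -mul2n E2; exact: eqxx.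
Qed.

Lemma excess_le : all (leq^~ (max_degree G - 1)) excess.
Proof.
apply/allP => _ /imageP[x _ ->] /=; rewrite -subn1 leq_sub2r //.
exact: leq_bigmax.
Qed.

Lemma max_degree_lt : 0 < #|G| -> max_degree G < #|G|.
Proof.
move=> G0; rewrite -(prednK G0) ltnS; apply/bigmax_leqP => x _.
rewrite -ltnS (prednK G0) -cardsT; apply: proper_card.
by apply/properP; split=> //; exists x; rewrite ?inE // adj_irr.
Qed.

Lemma count_excess : 2 < count (fun a => a != 0) excess.
Proof.
case: hG => conn [C [[c [szc Cc _]] _]].
rewrite count_map -size_filter.
have Uc : uniq c by case/andP: Cc.
apply: leq_trans (szc) _; apply: uniq_leq_size => // x xc.
rewrite mem_filter mem_enum andbT /=.
by have := deg_cycle szc Cc xc; case: (deg x) => [|[]].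
Qed.

End Excess.

(** * Degree sequences and the two bounds *)

Lemma sorted_nseq_cat k a s : path geq a s -> sorted geq (nseq k a ++ s).
Proof.
case: k => [|k] /=; first exact: path_sorted.
by elim: k => //= k IHk /IHk ->; rewrite /geq /= leqnn.
Qed.

Lemma path_nseq k a b : b <= a -> path geq a (nseq k b).
Proof. by elim: k a => //= k IHk a leba; rewrite /geq /= leba IHk. Qed.

(** All degrees are positive and both lists have [n] entries, so nonzero excesses determine the
    degree multiset; a sorted tuple is its own sorting. *)
Lemma K_classE (G : sgraph) n D : unicyclic G -> #|G| = n ->
  size (ztuple n D) = n -> all (leq 1) (ztuple n D) -> sorted geq (ztuple n D) ->
  K_class n D G <-> eq_upto0 (excess G) (map predn (ztuple n D)).
Proof.
move=> hG hn sz pos srt.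
have geq_trans : transitive geq by move=> y x z leyx lezy; apply: leq_trans lezy leyx.
have geq_anti : antisymmetric geq by move=> x y; rewrite andbC => /anti_leq.
have geq_total : total geq by move=> x y; apply: leq_total.
have zK : map succn (map predn (ztuple n D)) = ztuple n D.
  by rewrite -map_comp map_id_in // => a /(allP pos); apply: prednK.
have excessE : excess G = map predn [seq deg x | x : G] by rewrite -map_comp.
split=> [[_ _ Ez]|E].
  rewrite excessE -Ez; apply/perm_eq_upto0/perm_map.
  by rewrite perm_sym perm_sort.
split=> //; rewrite -(sorted_sort geq_trans srt); apply/perm_sortP => //.
rewrite -(succn_excess hG) -zK; apply/perm_map/eq_upto0_perm => //.
by rewrite !size_map sz -hn cardE enumT.
Qed.

Theorem theorem4p20 (G : sgraph) (n Delta : nat)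
    (hG : unicyclic G) (hn : #|G| = n) (hn4 : 4 <= n)
    (hDelta : max_degree G = Delta) (hDelta3 : 3 <= Delta) :
  let q := n %/ (Delta - 1) in
  (q = 1 \/ n = 2 * Delta - 2 ->
     NKstar G <= 4 * Delta ^ Delta * (n - Delta + 1) ^ (n - Delta + 1)
     /\ (NKstar G = 4 * Delta ^ Delta * (n - Delta + 1) ^ (n - Delta + 1)
         <-> K_class n Delta G))
  /\
  (1 < q -> n <> 2 * Delta - 2 ->
     NKstar G <= Delta ^ (q * Delta)
                 * (n - q * (Delta - 1) + 1) ^ (n - q * (Delta - 1) + 1)
     /\ (NKstar G = Delta ^ (q * Delta)
                    * (n - q * (Delta - 1) + 1) ^ (n - q * (Delta - 1) + 1)
         <-> K_class n Delta G)).
Proof.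
move=> q.
have ltDn : Delta < n by rewrite -hDelta -hn max_degree_lt // hn; lia.
have Es := sumn_excess hG; have le_s := excess_le G.
rewrite hn in Es; rewrite hDelta in le_s.
have weight_z z : map succn (map predn z) = z ->
    weight (map predn z) = \prod_(d <- z) d ^ d.
  by move=> zK; rewrite -{2}zK [RHS]big_map.
(* Both cases thus reduce to comparing the excess list with that of [ztuple]. *)
have extremal B : sorted geq (ztuple n Delta) -> all (leq 1) (ztuple n Delta) ->
    size (ztuple n Delta) = n -> \prod_(d <- ztuple n Delta) d ^ d = B ->
    weight (excess G) <= weight (map predn (ztuple n Delta))
      ?= iff eq_upto0 (excess G) (map predn (ztuple n Delta)) ->
    NKstar G <= B /\ (NKstar G = B <-> K_class n Delta G).
  move=> srt pos sz <- H; rewrite K_classE // -weight_excess // -weight_z.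
    by case: H => le_z <-; split=> //; split=> /eqP.
  by rewrite -map_comp map_id_in // => a /(allP pos); apply: prednK.
have Eq := divn_eq n (Delta - 1); rewrite -/q in Eq.
have ltr : n %% (Delta - 1) < Delta - 1 by rewrite ltn_mod; lia.
set r := n %% _ in Eq ltr.
have prod1 k : \prod_(d <- nseq k 1) d ^ d = 1.
  by rewrite big_nseq; elim: k => //= k ->.
split=> [q1 | q2 nE].
  have zE : ztuple n Delta = [:: Delta; n - Delta + 1; 2] ++ nseq (n - 3) 1.
    by rewrite /ztuple -/q; case: ifP => // /negP[]; case: q1 => /eqP ->; rewrite ?orbT.
  (* Together with [Delta < n], this is the range that [weight_three] requires for
     [m = Delta - 1]. *)
  have len : n <= 2 * (Delta - 1) by case: q1 => [q1|]; [rewrite q1 in Eq|]; lia.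
  apply: extremal; rewrite zE.
  - rewrite /= path_nseq // !andbT; apply/andP; split; rewrite /geq /=; lia.
  - by rewrite all_cat all_nseq /= orbT !andbT; lia.
  - by rewrite size_cat size_nseq /=; lia.
  - by rewrite big_cat prod1 !big_cons big_nil /= !muln1 mulnA mulnC mulnA.
  have [c [a [b [t [Pt c0 leca lecb]]]]] := three_nonzero (count_excess hG).
  have H := @weight_three (Delta - 1) c a b t c0 leca lecb.
  have Et : sumn [:: c, a, b & t] = n by rewrite -(perm_sumn Pt).
  rewrite Et -(perm_all _ Pt) in H.
  have Pu := perm_eq_upto0 Pt; rewrite /eq_upto0 perm_sym in Pu.
  apply: weight_leqif_congr Pu _ (H le_s _); last lia.
  rewrite (_ : (Delta - 1).+1 = Delta); last lia.
  (* Degrees 1 become zero excesses, leaving [Delta - 1], [n - Delta] and [1]. *)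
  rewrite map_cat map_nseq addn1 /= -(subn1 Delta).
  exact: (eq_upto0_cat_nseq [:: Delta - 1; n - Delta; 1]).
(* Entry [q + 1] has the remainder [r] as its excess. *)
have zE : ztuple n Delta = nseq q Delta ++ r.+1 :: nseq (n - q - 1) 1.
  rewrite /ztuple -/q; case: ifP => [/orP[]/eqP|_]; [lia|lia|].
  by congr (_ ++ _ :: _); lia.
(* Hence [2 * q <= n], so [n - q - 1] does not truncate. *)
have leqn : 2 * q <= q * (Delta - 1) by rewrite mulnC leq_mul2l; lia.
apply: extremal; rewrite zE.
- rewrite sorted_nseq_cat //= path_nseq // andbT /geq /=; lia.
- by rewrite all_cat /= !all_nseq /=; lia.
- by rewrite size_cat /= !size_nseq; lia.
- rewrite big_cat big_cons prod1 big_nseq /= muln1 iter_muln_1 -expnM mulnC.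
  by rewrite [Delta * q]mulnC mulnC; congr (_ * _ ^ _); lia.
have := weight_packed _ le_s; rewrite Es => H.
apply: weight_leqif_congr (perm_refl _) _ (H _); last by lia.
rewrite map_cat /= !map_nseq /= -cat_rcons.
apply: eq_upto0_trans (eq_upto0_cat_nseq _ (n - q - 1)).
apply: perm_eq_upto0; rewrite /packed -/q -/r subn1 perm_sym -cats1.
by rewrite perm_catC.
Qed.
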